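(* For all integers $p,q,k$ with $p\geq 3$, $1\leq q\leq p-2$ and $k\geq q$, we have $$g^k_{q}(p)\leq 2^{\frac{2k(p-2)}{q}+1}.$$
   Context: A Gallai-$k$-coloring of the complete graph $K_n$ is a map $c:E(K_n)\to\{1,\dots,k\}$ (not necessarily surjective) with no rainbow triangle, i.e. every triangle receives at most two distinct colors. For integers $k\ge 1$ and $1\le q\le \binom{p}{2}$, $g^k_q(p)$ denotes the smallest positive integer $n$ such that every Gallai-$k$-coloring of $K_n$ contains a copy of $K_p$ whose edges receive at most $q$ distinct colors. *)

(* Defs.v *)
From mathcomp Require Import all_boot.

Set Implicit Arguments.
Unset Strict Implicit.
Unset Printing Implicit Defensive.

(* Edges of the complete graph on the vertex set V. *)
Definition edge (V : finType) : finType := {e : {set V} | #|e| == 2}.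

Definition colors_on (V : finType) (k : nat) (c : edge V -> 'I_k) (A : {set V})
    : {set 'I_k} :=
  [set c e | e : edge V & val e \subset A].

Definition gallai_coloring (V : finType) (k : nat) (c : edge V -> 'I_k) : Prop :=
  forall T : {set V}, #|T| = 3 -> #|colors_on c T| <= 2.

Definition gallai_arrow (k q p n : nat) : Prop :=
  forall c : edge 'I_n -> 'I_k, gallai_coloring c ->
    exists A : {set 'I_n}, #|A| = p /\ #|colors_on c A| <= q.

(* The relation "g^k_q(p) = n". *)
Definition is_gallai_number (k q p n : nat) : Prop :=
  [/\ 0 < n, gallai_arrow k q p n
    & forall m : nat, 0 < m -> gallai_arrow k q p m -> n <= m].

(* Main.v *)
Require Import Defs.
From mathcomp Require Import all_boot all_order all_algebra.
From mathcomp Require Import boolp reals exp.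
From mathcomp Require Import zify.

Import GRing.Theory Num.Theory.
Local Open Scope ring_scope.

(** A Gallai colouring of n >= 2 vertices has a vertex with more than n/3
    incident edges of one colour.  Indeed, fix a vertex v and sort the other
    n-1 vertices by the colour of their edge to v.  Two vertices x, y of
    different classes form a triangle with v, which is not rainbow, so xy has
    the class colour of x or that of y.  Hence every ordered pair (x, y) is of
    one of three kinds, according to whether x and y share a class, xy has the
    class colour of x, or xy has the class colour of y.  If d is the largest
    monochromatic degree, each x lies in at most d pairs of the first kind and,
    since its edge to v also has its class colour, in at most d-1 pairs of each
    other kind; so n-1 <= 3d-2 ([large_star]).

    Now iterate: pick such a vertex, move to its large monochromatic
    neighbourhood, and repeat.  This yields a sequence of vertices, each joined
    to all later ones in a single colour.  If w i is the number of steps that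
    used colour i, then keeping the vertices with colour in Q, and the last
    vertex, gives a clique of size 1 + sum_(i in Q) w i all of whose colours are
    in Q ([monochromatic_forward_cliques]).  Among k colours the q most used
    ones carry a share of at least q/k of the steps ([heavy_subset]), so
    f + 1 steps with f = floor (k(p-2)/q) are enough for a clique of size p with
    at most q colours.  Each step divides the number of vertices by at most 3,
    and the last one only needs two vertices, so 2 * 3^f vertices suffice,
    which is at most 2 * 4^f <= 2^(2k(p-2)/q + 1). *)

(** * Colours of pairs of vertices *)

Section PairColor.
Variables (V : finType) (k : nat) (c : edge V -> 'I_k).

(** The value is [None] exactly on the diagonal; this avoids carrying proofs
    of distinctness around. *)
Definition pair_color (x y : V) : option 'I_k := omap c (insub [set x; y]).

Definition color_nbhd (S : {set V}) (i : option 'I_k) (x : V) : {set V} :=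
  [set y in S | (y != x) && (pair_color x y == i)].

Lemma pair_colorC x y : pair_color x y = pair_color y x.
Proof. by rewrite /pair_color setUC. Qed.

Lemma pair_color_edge x y : x != y ->
  exists2 e : edge V, val e = [set x; y] & pair_color x y = Some (c e).
Proof.
move=> xy; rewrite /pair_color.
case: insubP => [e _ ee|]; first by exists e.
by rewrite cards2 xy.
Qed.

Lemma colors_on_pair_color (A : {set V}) i : i \in colors_on c A ->
  exists x y, [/\ x \in A, y \in A, x != y & pair_color x y = Some i].
Proof.
case/imsetP => e; rewrite inE => eA ->.
have /cards2P[x [y [xy ee]]] := valP e.
exists x, y; split=> //.
- by apply: (subsetP eA); rewrite ee !inE eqxx.
- by apply: (subsetP eA); rewrite ee !inE eqxx orbT.
- by rewrite /pair_color -ee valK.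
Qed.

Lemma gallai_triangle x y z : gallai_coloring c ->
  x != y -> x != z -> y != z ->
  [|| pair_color x y == pair_color x z, pair_color y z == pair_color x y
    | pair_color y z == pair_color x z].
Proof.
move=> gc xy xz yz.
have [e1 v1 ->] := pair_color_edge _ _ xy.
have [e2 v2 ->] := pair_color_edge _ _ xz.
have [e3 v3 ->] := pair_color_edge _ _ yz.
have T3 : #|[set x; y; z]| = 3%N.
  by rewrite setUC cardsU1 cards2 xy !inE negb_or eq_sym xz eq_sym yz.
have := gc _ T3; apply: contraTT; rewrite !negb_or => /and3P[n12 n31 n32].
rewrite -ltnNge.
have sub : [set c e1; c e2; c e3] \subset colors_on c [set x; y; z].
  apply/subsetP => i; rewrite !inE => /orP[/orP[]|] /eqP->;
    apply/imsetP; [exists e1|exists e2|exists e3] => //;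
    rewrite inE ?v1 ?v2 ?v3; apply/subsetP => u; rewrite !inE;
    by case/orP=> ->; rewrite ?orbT.
apply: leq_trans (subset_leq_card sub).
rewrite setUC cardsU1 cards2 !inE negb_or.
have E a b : (Some (c a) == Some (c b)) = (c a == c b) by [].
by rewrite !E in n12 n31 n32; rewrite n12 n31 n32.
Qed.

(** * Large monochromatic stars *)

Lemma large_star (S : {set V}) : gallai_coloring c -> (1 < #|S|)%N ->
  exists2 x, x \in S & exists i, (#|S| < 3 * #|color_nbhd S (Some i) x|)%N.
Proof.
move=> gc S2.
have [/existsP[x /andP[xS /existsP[i h]]]|no] := boolP
  [exists x, (x \in S) && [exists i, #|S| < 3 * #|color_nbhd S (Some i) x|]]%N.
  by exists x => //; exists i.
exfalso.
have small x y : x \in S -> x != y ->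
    (3 * #|color_nbhd S (pair_color x y) x| <= #|S|)%N.
  move=> xS xy; have [e _ ->] := pair_color_edge _ _ xy.
  rewrite leqNgt; apply: contra no => h.
  by apply/existsP; exists x; rewrite xS; apply/existsP; exists (c e).
have /card_gt0P[v vS] : (0 < #|S|)%N by apply: ltnW.
pose X := S :\ v; pose cl x := pair_color v x.
have XS : #|S| = #|X|.+1 by rewrite (cardsD1 v) vS.
pose same x := (\sum_(y in X) (cl x == cl y))%N.
pose own x := (\sum_(y in X) ((y != x) && (pair_color x y == cl x)))%N.
have total : (#|X| * #|X| <= \sum_(x in X) (same x + own x + own x))%N.
  rewrite !big_split /=.
  (* with its sums exchanged, one copy of [own] counts the pairs that have the class colour of y *)
  rewrite [X in (_ <= _ + X)%N]exchange_big /= -!big_split /= -sum_nat_const.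
  apply: leq_sum => x; rewrite !inE => /andP[xv xS].
  rewrite -!big_split /= -sum1_card.
  apply: leq_sum => y; rewrite !inE => /andP[yv yS].
  have [->|xy] := eqVneq x y; first by rewrite eqxx.
  have := gallai_triangle v x y gc; rewrite ![v == _]eq_sym xv yv xy.
  move=> /(_ isT isT isT); rewrite /= (pair_colorC y x) /cl.
  by case/or3P => ->; lia.
have bound x : x \in X -> (3 * (same x + own x + own x) + 6 <= 3 * #|S|)%N.
  rewrite !inE => /andP[xv xS].
  have vx : v != x by rewrite eq_sym.
  have := small v x vS vx; have := small x v xS xv.
  (* the extra vertex is v, which lies in S but not in X *)
  have -> : #|color_nbhd S (pair_color x v) x| = (own x).+1.
    rewrite (cardsD1 v) !inE vS vx eqxx /= add1n; congr _.+1.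
    rewrite -sum1_card big_mkcond /own [RHS]big_mkcond /=.
    apply: eq_bigr => y _; rewrite !inE (pair_colorC x v).
    by rewrite -/(cl x); case: (y != v); case: (y \in S) => //=; case: (_ && _).
  have -> : #|color_nbhd S (pair_color v x) v| = same x.
    rewrite -sum1_card big_mkcond /same [RHS]big_mkcond /=.
    apply: eq_bigr => y _; rewrite !inE /cl (eq_sym (pair_color v y)).
    by case: (y != v); case: (y \in S) => //=; case: (_ == _).
  lia.
have : (\sum_(x in X) (3 * (same x + own x + own x) + 6) <=
        \sum_(x in X) 3 * #|S|)%N by apply: leq_sum.
rewrite [X in (_ <= X)%N]sum_nat_const big_split /= sum_nat_const -big_distrr /=.
by rewrite XS in S2 *; nia.
Qed.

(** * Cliques from sequences of stars *)

(** The sequence of stars is recorded only through the number w i of steps of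
    each colour.  This loses nothing: a new vertex v joined in colour i to all
    of the smaller set extends the cliques of those Q that contain i, and
    leaves the others alone.  The assumption says 2 * 3^(t-1) <= #|S| without
    the predecessor, so that the induction can start from a single vertex at
    t = 0. *)
Lemma monochromatic_forward_cliques (t : nat) (S : {set V}) :
  gallai_coloring c -> (2 * 3 ^ t <= 3 * #|S|)%N ->
  exists2 w : 'I_k -> nat, (\sum_i w i = t)%N &
    forall Q : {set 'I_k}, exists A : {set V},
      [/\ A \subset S, #|A| = (\sum_(i in Q) w i).+1 & colors_on c A \subset Q].
Proof.
move=> gc; elim: t S => [|t IH] S hS.
  have /card_gt0P[v vS] : (0 < #|S|)%N by lia.
  exists (fun=> 0%N); first by rewrite big1.
  move=> Q; exists [set v]; split; first by rewrite sub1set.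
    by rewrite cards1 big1.
  apply/subsetP => i /colors_on_pair_color[x [y []]].
  by rewrite !inE => /eqP-> /eqP->; rewrite eqxx.
have t0 : (0 < 3 ^ t)%N by rewrite expn_gt0.
have [|v vS [i hi]] := large_star S gc; first by rewrite expnS in hS; lia.
have [|w ws wA] := IH (color_nbhd S (Some i) v).
  by rewrite expnS in hS; lia.
exists (fun j => (j == i) + w j)%N.
  by rewrite big_split /= ws (bigD1 i) //= eqxx big1 // => j /negPf->.
move=> Q; have [A [AS AQ cA]] := wA Q.
have AnS : A \subset S.
  by apply: subset_trans AS _; apply/subsetP => y; rewrite inE => /andP[].
have [iQ|iQ] := boolP (i \in Q); last first.
  exists A; split=> //; rewrite AQ; congr _.+1; apply: eq_bigr => j jQ.
  by case: eqP iQ => // <-; rewrite jQ.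
have vA : v \notin A.
  by apply/negP => /(subsetP AS); rewrite inE eqxx andbF.
have vcol y : y \in A -> pair_color v y = Some i.
  by move=> /(subsetP AS); rewrite inE => /and3P[_ _ /eqP].
exists (v |: A); split; first by rewrite subUset sub1set vS.
  have one : (\sum_(j in Q) (j == i) = 1)%N.
    by rewrite (bigD1 i) //= eqxx big1 // => j /andP[_ /negPf->].
  by rewrite cardsU1 vA AQ big_split /= one.
apply/subsetP => j /colors_on_pair_color[x [y []]].
have inQ u : Some i = Some u -> u \in Q by case=> <-.
rewrite !inE => /orP[/eqP->|xA] /orP[/eqP->|yA] xy.
- by rewrite eqxx in xy.
- by rewrite vcol //; apply: inQ.
- by rewrite pair_colorC vcol //; apply: inQ.
move=> xyj; apply: (subsetP cA); have [e ve] := pair_color_edge _ _ xy.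
rewrite xyj => -[->]; apply/imsetP; exists e => //.
by rewrite inE ve subUset !sub1set xA.
Qed.

End PairColor.

(** * The most used colours *)

Lemma exists_subset_card (T : finType) (A : {set T}) (m : nat) :
  (m <= #|A|)%N -> exists2 B : {set T}, B \subset A & #|B| = m.
Proof.
move=> mA; exists [set x in take m (enum A)].
  by apply/subsetP => x; rewrite inE => /mem_take; rewrite mem_enum.
rewrite cardsE (card_uniqP _) ?take_uniq ?enum_uniq //.
by rewrite size_takel // -cardE.
Qed.

(** A q-subset of maximal weight works: exchanging an element of it for one
    outside cannot increase the weight, so every element of it is at least as
    heavy as every element outside. *)
Lemma heavy_subset (T : finType) (w : T -> nat) (q : nat) : (q <= #|T|)%N ->
  exists2 Q : {set T}, #|Q| = q &
    (q * \sum_i w i <= #|T| * \sum_(i in Q) w i)%N.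
Proof.
rewrite -cardsT => /exists_subset_card[Q0 _ /eqP Q0q].
pose P := [pred Q : {set T} | #|Q| == q].
have [Q /eqP Qq Qmax] :=
  arg_maxnP (P := P) (fun Q : {set T} => \sum_(i in Q) w i)%N Q0q.
exists Q => //.
have exch i j : i \in Q -> j \in ~: Q -> (w j <= w i)%N.
  rewrite inE => iQ jQ; have jQi : j \notin Q :\ i by rewrite inE negb_and jQ orbT.
  have /Qmax : P (j |: (Q :\ i)).
    by rewrite /= cardsU1 jQi -Qq (cardsD1 i Q) iQ.
  by rewrite /= big_setU1 //= (big_setD1 i iQ) /= leq_add2r.
have : (\sum_(i in Q) \sum_(j in ~: Q) w j <=
        \sum_(i in Q) \sum_(j in ~: Q) w i)%N.
  by apply: leq_sum => i iQ; apply: leq_sum => j jQ; apply: exch.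
rewrite sum_nat_const Qq.
under [X in (_ <= X)%N]eq_bigr do rewrite sum_nat_const.
rewrite -big_distrr /= => le.
have -> : (\sum_i w i = \sum_(i in Q) w i + \sum_(j in ~: Q) w j)%N.
  by rewrite (bigID (mem Q)) /=; congr addn; apply: eq_bigl => i; rewrite inE.
by rewrite cardsT -(cardsC Q) Qq mulnDr mulnDl leq_add2l.
Qed.

(** * The bound *)

(** One step more than k(p-2)/q rounded down makes the q heaviest colours carry
    strictly more than p-2 steps; the last vertex completes the clique. *)
Lemma gallai_arrow_exp (k q p : nat) : (1 < p)%N -> (0 < q <= k)%N ->
  gallai_arrow k q p (2 * 3 ^ (k * (p - 2) %/ q)).
Proof.
move=> p2 /andP[q0 qk] c gc; set f := (k * (p - 2) %/ q)%N.
have fq : (k * (p - 2) < q * f.+1)%N by rewrite [ltnRHS]mulnC ltn_ceil.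
have [|w ws wA] := monochromatic_forward_cliques _ k c f.+1 setT gc.
  by rewrite cardsT card_ord -/f expnS mulnCA.
have [|Q Qq] := heavy_subset _ w q; first by rewrite card_ord.
rewrite ws card_ord => wQ.
have [B [_ BQ cB]] := wA Q.
have [|A AB Ap] := exists_subset_card _ B p; last first.
  exists A; split=> //; rewrite -Qq; apply/subset_leq_card/(subset_trans _ cB).
  apply/subsetP => i /imsetP[e]; rewrite inE => eA ->.
  by apply/imsetP; exists e; rewrite // inE (subset_trans eA AB).
by have := leq_trans fq wQ; rewrite ltn_mul2l BQ ltn_subLR // => /andP[_].
Qed.

Lemma gallai_number_le (k q p n : nat) : (0 < n)%N -> gallai_arrow k q p n ->
  exists2 m : nat, is_gallai_number k q p m & (m <= n)%N.
Proof.
move=> n0 an; pose P m := (0 < m)%N && `[< gallai_arrow k q p m >].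
have exP : exists m, P m by exists n; rewrite /P n0; apply/asboolP.
have [m /andP[m0 /asboolP am] mmin] := ex_minnP exP.
exists m; last by apply: mmin; rewrite /P n0; apply/asboolP.
by split=> // l l0 al; apply: mmin; rewrite /P l0; apply/asboolP.
Qed.

Theorem theorem1p4 (R : realType) (p q k : nat)
    (hp : (3 <= p)%N) (hq1 : (1 <= q)%N) (hqp : (q <= p - 2)%N)
    (hkq : (q <= k)%N) :
  exists n : nat, is_gallai_number k q p n /\
    (n%:R : R) <= 2 `^ (2 * k%:R * (p%:R - 2) / q%:R + 1).
Proof.
set f := (k * (p - 2) %/ q)%N.
have [||n gn nle] := gallai_number_le k q p (2 * 3 ^ f).
- by rewrite muln_gt0 expn_gt0.
- by apply: gallai_arrow_exp; [lia | rewrite hq1].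
exists n; split=> //.
have n2 : (n <= 2 ^ (2 * f + 1))%N.
  by apply: leq_trans nle _; rewrite addn1 expnS expnM; case: f => // f; rewrite leq_mul2l leq_exp2r.
have q0 : (0 : R) < q%:R by rewrite ltr0n.
apply: (@Order.POrderTheory.le_trans _ _ (2 `^ (2 * f + 1)%:R)).
  by rewrite powR_mulrn // -natrX ler_nat.
rewrite ler_powR ?ler1n // natrD natrM lerD2r -!mulrA ler_pM2l //.
rewrite -natrB; last by lia.
by rewrite mulrA ler_pdivlMr // -!natrM ler_nat leq_divM.
Qed.
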